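(* Let $\beta\ge1$, and let $\phi^{n-2},\phi^{n-1},\phi^n,\phi^{n+1}$ be elements of a real inner product space with inner product $(\cdot,\cdot)$ and norm $|\cdot|$. (1) One has $$\big(D_3^\beta(\phi^{n+1}),C_3^\beta(\phi^{n+1})\big)=\hat a_3|\phi^{n+1}|^2-\hat a_3|\phi^n|^2+|\hat b_3\phi^{n+1}+\hat c_3\phi^n|^2-|\hat b_3\phi^n+\hat c_3\phi^{n-1}|^2+|\hat d_3\phi^{n+1}+\hat e_3\phi^n+\hat f_3\phi^{n-1}|^2,$$ where the coefficients are given by $$\hat M=\tfrac{2\beta^3+4\beta^2+\beta+1}{\beta+1},\quad \hat N=\tfrac{(2\beta^2+2\beta-1)^2}{4},\quad \hat\Delta_3=\hat M^2-4\hat N=\tfrac{4\beta(2\beta^2+4\beta+1)}{(\beta+1)^2},\quad \hat e_3=-\sqrt{\tfrac{\hat M-\sqrt{\hat\Delta_3}}{2}},$$ $$\hat P=\tfrac{\beta^3+2\beta^2+1}{\beta+1}-\hat e_3^2,\quad \hat Q=\tfrac{2\beta^3+4\beta^2+\beta+1}{\beta+1}-\hat e_3^2,\quad \hat f_3=\tfrac{-\sqrt{\hat P}+\sqrt{\hat Q}}{2},\quad \hat c_3=\hat f_3,$$ $$\hat d_3=\sqrt{\hat P}+\hat f_3,\quad \hat b_3=\tfrac{\beta(\beta-1)+4\hat e_3\hat f_3}{4\hat c_3},\quad \hat a_3=\tfrac{\beta^2}{2}+\tfrac{3\beta}{2}+1-\hat b_3^2-\hat d_3^2 .$$ (2) One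 has $$\begin{aligned}\big(A_3^\beta(\phi^{n+1}),C_3^\beta(\phi^{n+1})\big)={}&a_3|\phi^{n+1}|^2-a_3|\phi^n|^2+|b_3\phi^{n+1}+c_3\phi^n|^2-|b_3\phi^n+c_3\phi^{n-1}|^2\\&+|d_3\phi^{n+1}+e_3\phi^n+f_3\phi^{n-1}|^2-|d_3\phi^n+e_3\phi^{n-1}+f_3\phi^{n-2}|^2\\&+|g_3\phi^{n+1}+h_3\phi^n+i_3\phi^{n-1}+j_3\phi^{n-2}|^2 ,\end{aligned}$$ where the coefficients are given by $$M=2\beta^4+6\beta^3+\tfrac{13\beta^2}{3}-\tfrac{\beta}{3}-\tfrac13,\quad N=-\big(\tfrac{\beta^2}{2}-\tfrac16\big)\big(\tfrac{\beta^2}{2}+\tfrac{3\beta}{2}+1\big),\quad P=\tfrac{\sqrt M+1}{2},$$ $$Q=-\tfrac12\beta\big(\tfrac{\beta^2}{2}-\tfrac16\big)(\beta+1),\quad R=\beta^4+\tfrac{7\beta^3}{2}+\tfrac{19\beta^2}{6}-\tfrac{\beta}{3}-1,\quad S=\tfrac{7\beta^4}{4}+\tfrac{25\beta^3}{4}+\tfrac{17\beta^2}{3}+\tfrac{\beta}{2}+\tfrac13,$$ $$W=\big(\tfrac{\beta^2}{2}+\tfrac{3\beta}{2}+1\big)\big(\tfrac{\beta^2}{2}+\beta+\tfrac13\big),\quad U=\tfrac12-\tfrac{79\beta^2}{12}-\tfrac{21\beta^3}{4}-\tfrac{5\beta^4}{4}-\tfrac{23\beta}{12},$$ $$f_3=\tfrac{\sqrt{P^2+2N}+P}{2},\quad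 j_3=f_3,\quad g_3=f_3-P,\quad i_3=-\sqrt M-g_3,\quad h_3=\sqrt M-f_3,\quad e_3=\tfrac{2i_3j_3-Q}{2f_3},$$ $$d_3=\tfrac{R-2g_3i_3}{2f_3},\quad c_3=\sqrt{S-e_3^2-g_3^2-h_3^2},\quad b_3=\tfrac{U-2d_3e_3-2g_3h_3}{2c_3},\quad a_3=W-g_3^2-d_3^2-b_3^2 .$$ Moreover, it is numerically verified that all the variables appearing in the two lists of coefficients above are real and bounded, and that $\hat a_3,\,a_3>0$, for $1\le\beta\le100$.
   Context: $A_3^\beta(\phi^{n+1})=\frac{3\beta^2+6\beta+2}{6}\phi^{n+1}-\frac{9\beta^2+12\beta-3}{6}\phi^n+\frac{9\beta^2+6\beta-6}{6}\phi^{n-1}-\frac{3\beta^2-1}{6}\phi^{n-2}$, $C_3^\beta(\phi^{n+1})=\frac{\beta^2+3\beta+2}{2}\phi^{n+1}-(\beta^2+2\beta)\phi^n+\frac{\beta^2+\beta}{2}\phi^{n-1}$, $D_3^\beta(\phi^{n+1})=\phi^{n+1}+\frac{1-\beta}{1+\beta}\phi^n$. The final assertion (reality, boundedness, positivity for $1\le\beta\le100$) is supported by numerical verification rather than by proof. *)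

(* Defs.v *)
From HB Require Import structures.
From mathcomp Require Import all_boot all_order all_algebra.
From mathcomp Require Import all_classical all_reals all_analysis.

Set Implicit Arguments.
Unset Strict Implicit.
Unset Printing Implicit Defensive.
Import Order.TTheory GRing.Theory Num.Theory.
Import numFieldNormedType.Exports.
Local Open Scope classical_set_scope.
Local Open Scope ring_scope.

(* [{dot V for idfun}] is the type of symmetric positive definite bilinear
   forms on [V]: over a [realType] these are the real inner products. *)
Definition ipnorm (R : realType) (V : lmodType R) (ip : {dot V for idfun})
  (x : V) : R := Num.sqrt (ip x x).

(* The arguments [x3 x2 x1 x0] are phi^(n+1), phi^n, phi^(n-1), phi^(n-2). *)
Section Operators.
Variables (R : realType) (V : lmodType R) (beta : R).

Definition A3 (x3 x2 x1 x0 : V) : V :=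
  ((3 * beta ^+ 2 + 6 * beta + 2) / 6) *: x3
  - ((9 * beta ^+ 2 + 12 * beta - 3) / 6) *: x2
  + ((9 * beta ^+ 2 + 6 * beta - 6) / 6) *: x1
  - ((3 * beta ^+ 2 - 1) / 6) *: x0.

Definition C3 (x3 x2 x1 : V) : V :=
  ((beta ^+ 2 + 3 * beta + 2) / 2) *: x3
  - (beta ^+ 2 + 2 * beta) *: x2
  + ((beta ^+ 2 + beta) / 2) *: x1.

Definition D3 (x3 x2 : V) : V := x3 + ((1 - beta) / (1 + beta)) *: x2.

End Operators.

Section HatCoefficients.
Variables (R : realType) (beta : R).

Definition hatM : R :=
  (2 * beta ^+ 3 + 4 * beta ^+ 2 + beta + 1) / (beta + 1).
Definition hatN : R := (2 * beta ^+ 2 + 2 * beta - 1) ^+ 2 / 4.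
Definition hatDelta3 : R := hatM ^+ 2 - 4 * hatN.
Definition hate3 : R := - Num.sqrt ((hatM - Num.sqrt hatDelta3) / 2).
Definition hatP : R :=
  (beta ^+ 3 + 2 * beta ^+ 2 + 1) / (beta + 1) - hate3 ^+ 2.
Definition hatQ : R :=
  (2 * beta ^+ 3 + 4 * beta ^+ 2 + beta + 1) / (beta + 1) - hate3 ^+ 2.
Definition hatf3 : R := (- Num.sqrt hatP + Num.sqrt hatQ) / 2.
Definition hatc3 : R := hatf3.
Definition hatd3 : R := Num.sqrt hatP + hatf3.
Definition hatb3 : R :=
  (beta * (beta - 1) + 4 * hate3 * hatf3) / (4 * hatc3).
Definition hata3 : R :=
  beta ^+ 2 / 2 + 3 * beta / 2 + 1 - hatb3 ^+ 2 - hatd3 ^+ 2.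

(* [Num.sqrt] and division are total on [R] (with value 0 on negative numbers
   and for zero denominators), so "the variables are real" is the statement
   that every radicand is nonnegative and every denominator is nonzero. *)
Definition hat_variables_real : Prop :=
  (beta + 1 != 0 /\ 4 * hatc3 != 0) /\
  [/\ 0 <= hatDelta3, 0 <= (hatM - Num.sqrt hatDelta3) / 2,
      0 <= hatP & 0 <= hatQ].

End HatCoefficients.

Section Coefficients.
Variables (R : realType) (beta : R).

Definition coefM : R :=
  2 * beta ^+ 4 + 6 * beta ^+ 3 + 13 * beta ^+ 2 / 3 - beta / 3 - 1 / 3.
Definition coefN : R :=
  - ((beta ^+ 2 / 2 - 1 / 6) * (beta ^+ 2 / 2 + 3 * beta / 2 + 1)).
Definition coefP : R := (Num.sqrt coefM + 1) / 2.
Definition coefQ : R :=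
  - (1 / 2) * beta * (beta ^+ 2 / 2 - 1 / 6) * (beta + 1).
Definition coefR : R :=
  beta ^+ 4 + 7 * beta ^+ 3 / 2 + 19 * beta ^+ 2 / 6 - beta / 3 - 1.
Definition coefS : R :=
  7 * beta ^+ 4 / 4 + 25 * beta ^+ 3 / 4 + 17 * beta ^+ 2 / 3
  + beta / 2 + 1 / 3.
Definition coefW : R :=
  (beta ^+ 2 / 2 + 3 * beta / 2 + 1) * (beta ^+ 2 / 2 + beta + 1 / 3).
Definition coefU : R :=
  1 / 2 - 79 * beta ^+ 2 / 12 - 21 * beta ^+ 3 / 4 - 5 * beta ^+ 4 / 4
  - 23 * beta / 12.
Definition f3 : R := (Num.sqrt (coefP ^+ 2 + 2 * coefN) + coefP) / 2.
Definition j3 : R := f3.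
Definition g3 : R := f3 - coefP.
Definition i3 : R := - Num.sqrt coefM - g3.
Definition h3 : R := Num.sqrt coefM - f3.
Definition e3 : R := (2 * i3 * j3 - coefQ) / (2 * f3).
Definition d3 : R := (coefR - 2 * g3 * i3) / (2 * f3).
Definition c3 : R := Num.sqrt (coefS - e3 ^+ 2 - g3 ^+ 2 - h3 ^+ 2).
Definition b3 : R := (coefU - 2 * d3 * e3 - 2 * g3 * h3) / (2 * c3).
Definition a3 : R := coefW - g3 ^+ 2 - d3 ^+ 2 - b3 ^+ 2.

(* See [hat_variables_real]. *)
Definition variables_real : Prop :=
  (2 * f3 != 0 /\ 2 * c3 != 0) /\
  [/\ 0 <= coefM, 0 <= coefP ^+ 2 + 2 * coefN
    & 0 <= coefS - e3 ^+ 2 - g3 ^+ 2 - h3 ^+ 2].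

End Coefficients.

Definition hat_variables (R : realType) : seq (R -> R) :=
  [:: @hatM R; @hatN R; @hatDelta3 R; @hate3 R; @hatP R; @hatQ R; @hatf3 R;
      @hatc3 R; @hatd3 R; @hatb3 R; @hata3 R].

Definition variables (R : realType) : seq (R -> R) :=
  [:: @coefM R; @coefN R; @coefP R; @coefQ R; @coefR R; @coefS R; @coefW R;
      @coefU R; @f3 R; @j3 R; @g3 R; @i3 R; @h3 R; @e3 R; @d3 R; @c3 R;
      @b3 R; @a3 R].

(* Main.v *)
(* Comparing the coefficients of the products (phi^i, phi^j) on both sides
   reduces each identity to polynomial relations between the coefficients.

   For the second identity put s = sqrt M and g = g_3.  Then
   g^2 + (s + 1) / 2 * g = N / 2, and since M, N, Q, R factor suitably all the
   divisions by f_3 disappear: e_3 and d_3, like f_3, h_3 and i_3, are linear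
   in s and g over Q(beta).  With
     G22 = S - e^2 - g^2 - h^2 = c^2, G33 = W - g^2 - d^2 = a + b^2,
     G32 = U/2 - de - gh = bc,
   reality of c_3 and positivity of a_3 amount to G22 > 0 and
   G22 * G33 - G32^2 > 0, and both expressions reduce to the form
   (positive) + g * (positive), which is positive already because
   - g <= (s + 1) / 4.

   For the first identity put p = sqrt P^, q = sqrt Q^ and
   k = (beta - 1) / (beta + 1).  Then d^ = (p + q) / 2 and
   b^ = k * d^ + e^, so that a^ = X - p * Y with X free of p and q, and
   X^2 - p^2 * Y^2 = 1 / 4 identically in beta.

   The quotients b_3, d_3, e_3, b^ are bounded because their squares are at
   most W, W, S and beta^2 / 2 + 3 * beta / 2 + 1, respectively. *)
Require Import Defs.
From Stdlib Require List.
From HB Require Import structures.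
From mathcomp Require Import all_boot all_order all_algebra.
From mathcomp Require Import all_classical all_reals all_analysis.
From mathcomp Require Import ring lra.

Set Implicit Arguments.
Unset Strict Implicit.
Unset Printing Implicit Defensive.
Import Order.TTheory GRing.Theory Num.Theory.
Import numFieldNormedType.Exports.
Local Open Scope classical_set_scope.
Local Open Scope ring_scope.

(** * Bilinear expansion and comparison of Gram entries *)

Section InnerProduct.
Variables (R : realType) (V : lmodType R) (ip : {dot V for idfun}).

Lemma ipDl x y z : ip (x + y) z = ip x z + ip y z.
Proof. by rewrite linearDl. Qed.

Lemma ipDr x y z : ip z (x + y) = ip z x + ip z y.
Proof. by rewrite linearDr. Qed.

Lemma ipNl x z : ip (- x) z = - ip x z.
Proof. by rewrite linearNl. Qed.

Lemma ipNr x z : ip z (- x) = - ip z x.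
Proof. by rewrite linearNr. Qed.

Lemma ipZl a x z : ip (a *: x) z = a * ip x z.
Proof. by rewrite linearZl_LR. Qed.

Lemma ipZr a x z : ip z (a *: x) = a * ip z x.
Proof. by rewrite linearZr_LR. Qed.

Lemma ipC x y : ip x y = ip y x.
Proof. by rewrite hermitian_subproof expr0 mul1r. Qed.

Lemma ipnormK x : ipnorm ip x ^+ 2 = ip x x.
Proof.
rewrite sqr_sqrtr //; have [->|/neq0_dnorm_gt0/ltW//] := eqVneq x 0.
by rewrite linear0l.
Qed.

Definition ipE := (ipDl, ipDr, ipNl, ipNr, ipZl, ipZr).

(** There is one hypothesis per product of vectors; [f ^+ 2 = c ^+ 2] is the [ip x0 x0] entry,
    absent from the left side. *)
Lemma gram_form3 (x2 x1 x0 : V) (k2 k1 l2 l1 l0 a b c d e f : R) :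
  k2 * l2 = a + b ^+ 2 + d ^+ 2 ->
  k1 * l1 = - a + c ^+ 2 - b ^+ 2 + e ^+ 2 ->
  f ^+ 2 = c ^+ 2 ->
  k2 * l1 + k1 * l2 = 2 * (b * c) + 2 * (d * e) ->
  k2 * l0 = 2 * (d * f) ->
  k1 * l0 = - (2 * (b * c)) + 2 * (e * f) ->
  ip (k2 *: x2 + k1 *: x1) (l2 *: x2 + l1 *: x1 + l0 *: x0) =
    a * ipnorm ip x2 ^+ 2 - a * ipnorm ip x1 ^+ 2
    + ipnorm ip (b *: x2 + c *: x1) ^+ 2 - ipnorm ip (b *: x1 + c *: x0) ^+ 2
    + ipnorm ip (d *: x2 + e *: x1 + f *: x0) ^+ 2.
Proof.
move=> h22 h11 h00 h21 h20 h10.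
rewrite !ipnormK !ipE (ipC x1 x2) (ipC x0 x2) (ipC x0 x1).
transitivity (k2 * l2 * ip x2 x2 + k1 * l1 * ip x1 x1
  + (k2 * l1 + k1 * l2) * ip x2 x1 + k2 * l0 * ip x2 x0 + k1 * l0 * ip x1 x0).
  by ring.
rewrite h22 h11 h21 h20 h10.
(* The vanishing [ip x0 x0] term is reinstated so that [ring] can match the expanded squares. *)
transitivity ((a + b ^+ 2 + d ^+ 2) * ip x2 x2
  + (- a + c ^+ 2 - b ^+ 2 + e ^+ 2) * ip x1 x1
  + (2 * (b * c) + 2 * (d * e)) * ip x2 x1 + 2 * (d * f) * ip x2 x0
  + (- (2 * (b * c)) + 2 * (e * f)) * ip x1 x0
  + (f ^+ 2 - c ^+ 2) * ip x0 x0); last by ring.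
by rewrite h00 subrr mul0r addr0.
Qed.

Lemma gram_form4 (x3 x2 x1 x0 : V)
    (k3 k2 k1 k0 l3 l2 l1 a b c d e f g h i j : R) :
  k3 * l3 = a + b ^+ 2 + d ^+ 2 + g ^+ 2 ->
  k2 * l2 = - a + c ^+ 2 - b ^+ 2 + e ^+ 2 - d ^+ 2 + h ^+ 2 ->
  k1 * l1 = - c ^+ 2 + f ^+ 2 - e ^+ 2 + i ^+ 2 ->
  j ^+ 2 = f ^+ 2 ->
  k3 * l2 + k2 * l3 = 2 * (b * c) + 2 * (d * e) + 2 * (g * h) ->
  k3 * l1 + k1 * l3 = 2 * (d * f) + 2 * (g * i) ->
  k2 * l1 + k1 * l2
    = - (2 * (b * c)) + 2 * (e * f) - 2 * (d * e) + 2 * (h * i) ->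
  k0 * l3 = 2 * (g * j) ->
  k0 * l2 = - (2 * (d * f)) + 2 * (h * j) ->
  k0 * l1 = - (2 * (e * f)) + 2 * (i * j) ->
  ip (k3 *: x3 + k2 *: x2 + k1 *: x1 + k0 *: x0)
     (l3 *: x3 + l2 *: x2 + l1 *: x1) =
    a * ipnorm ip x3 ^+ 2 - a * ipnorm ip x2 ^+ 2
    + ipnorm ip (b *: x3 + c *: x2) ^+ 2 - ipnorm ip (b *: x2 + c *: x1) ^+ 2
    + ipnorm ip (d *: x3 + e *: x2 + f *: x1) ^+ 2
    - ipnorm ip (d *: x2 + e *: x1 + f *: x0) ^+ 2
    + ipnorm ip (g *: x3 + h *: x2 + i *: x1 + j *: x0) ^+ 2.
Proof.
move=> h33 h22 h11 h00 h32 h31 h21 h30 h20 h10.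
rewrite !ipnormK !ipE (ipC x2 x3) (ipC x1 x3) (ipC x1 x2) (ipC x0 x3)
  (ipC x0 x2) (ipC x0 x1).
transitivity (k3 * l3 * ip x3 x3 + k2 * l2 * ip x2 x2 + k1 * l1 * ip x1 x1
  + (k3 * l2 + k2 * l3) * ip x3 x2 + (k3 * l1 + k1 * l3) * ip x3 x1
  + (k2 * l1 + k1 * l2) * ip x2 x1 + k0 * l3 * ip x3 x0
  + k0 * l2 * ip x2 x0 + k0 * l1 * ip x1 x0); first by ring.
rewrite h33 h22 h11 h32 h31 h21 h30 h20 h10.
transitivity ((a + b ^+ 2 + d ^+ 2 + g ^+ 2) * ip x3 x3
  + (- a + c ^+ 2 - b ^+ 2 + e ^+ 2 - d ^+ 2 + h ^+ 2) * ip x2 x2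
  + (- c ^+ 2 + f ^+ 2 - e ^+ 2 + i ^+ 2) * ip x1 x1
  + (2 * (b * c) + 2 * (d * e) + 2 * (g * h)) * ip x3 x2
  + (2 * (d * f) + 2 * (g * i)) * ip x3 x1
  + (- (2 * (b * c)) + 2 * (e * f) - 2 * (d * e) + 2 * (h * i)) * ip x2 x1
  + 2 * (g * j) * ip x3 x0
  + (- (2 * (d * f)) + 2 * (h * j)) * ip x2 x0
  + (- (2 * (e * f)) + 2 * (i * j)) * ip x1 x0
  + (j ^+ 2 - f ^+ 2) * ip x0 x0); last by ring.
by rewrite h00 subrr mul0r addr0.
Qed.

End InnerProduct.

(** Serves for equalities modulo relations: [e] is a combination of expressions known to vanish, and
    [x - y = e] is left to [field]. *)
Lemma eq_subr_eq0 (V : zmodType) (x y e : V) : e = 0 -> x - y = e -> x = y.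
Proof. by move=> -> /subr0_eq. Qed.

(* [lra] treats the powers of a variable as independent atoms. *)
Ltac pos_powers x0 :=
  have := exprn_ge0 2 x0; have := exprn_ge0 3 x0; have := exprn_ge0 4 x0;
  have := exprn_ge0 5 x0; have := exprn_ge0 6 x0.

(** * Coefficients of the second identity, expressed through [s] and [g] *)

(* [Defs.] is needed: [coefM], [coefP], ... are also lemmas of [poly]. *)
Section NonhatCoefficients.
Variables (R : realType) (b : R).
Hypothesis b1 : 1 <= b.

Let s := Num.sqrt (Defs.coefM b).
Let g := g3 b.

Lemma coefM_gt0 : 0 < Defs.coefM b.
Proof.
(* As a polynomial in [x = b - 1], [coefM] has only positive coefficients. *)
rewrite /Defs.coefM; have [x x0 ->] : exists2 x, 0 <= x & b = 1 + x.
  by exists (b - 1); [rewrite subr_ge0|ring].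
by pos_powers x0; lra.
Qed.

Lemma sqrtM_ge0 : 0 <= s. Proof. exact: sqrtr_ge0. Qed.

Lemma sqr_sqrtM : s ^+ 2 = Defs.coefM b.
Proof. by rewrite sqr_sqrtr// ltW// coefM_gt0. Qed.

(** Modulo [s ^+ 2 = coefM b] the terms in [b ^+ 4] and [b ^+ 3] cancel, and what is left is visibly
    nonnegative. *)
Lemma discriminantE :
  Defs.coefP b ^+ 2 + 2 * Defs.coefN b = (b ^+ 2 + 5 / 3 * b + 2 + 2 * s) / 4.
Proof.
apply: (@eq_subr_eq0 _ _ _ ((s ^+ 2 - Defs.coefM b) / 4)).
  by rewrite sqr_sqrtM subrr mul0r.
by rewrite /Defs.coefP -/s /Defs.coefN /Defs.coefM; field.
Qed.

Lemma discriminant_ge0 : 0 <= Defs.coefP b ^+ 2 + 2 * Defs.coefN b.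
Proof.
rewrite discriminantE; have := sqrtM_ge0; have := sqr_ge0 b.
by move: b1; lra.
Qed.

(** With [u] the square root in [f3], [g = (u - coefP b) / 2] is a root of
    [X ^+ 2 + coefP b * X - coefN b / 2]. *)
Lemma g3_sqr : g ^+ 2 = Defs.coefN b / 2 - (s + 1) / 2 * g.
Proof.
have h := sqr_sqrtr discriminant_ge0.
rewrite /g /g3 /f3 -[(s + 1) / 2]/(Defs.coefP b).
move: (Num.sqrt _) h => u h.
apply: (@eq_subr_eq0 _ _ _
  ((u ^+ 2 - (Defs.coefP b ^+ 2 + 2 * Defs.coefN b)) / 4)).
  by rewrite h subrr mul0r.
by field.
Qed.

Lemma g3_ge : - (s + 1) / 4 <= g.
Proof.
rewrite /g /g3 /f3 /Defs.coefP -/s.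
by have := sqrtr_ge0 (((s + 1) / 2) ^+ 2 + 2 * Defs.coefN b); lra.
Qed.

Lemma f3E : f3 b = g + (s + 1) / 2.
Proof. by rewrite /g /g3 /Defs.coefP -/s; ring. Qed.

Lemma f3_gt0 : 0 < f3 b.
Proof. by rewrite f3E; have := g3_ge; have := sqrtM_ge0; lra. Qed.

Lemma g3_f3 : g * f3 b = Defs.coefN b / 2.
Proof. by rewrite f3E mulrDr -expr2 g3_sqr; ring. Qed.

Lemma i3E : i3 b = - s - g. Proof. by []. Qed.

Lemma h3E : h3 b = (s - 1) / 2 - g.
Proof. by rewrite /h3 f3E -/s; field. Qed.

Let f_neq0 : f3 b != 0. Proof. by rewrite gt_eqF// f3_gt0. Qed.
Let b1_neq0 : b + 1 != 0. Proof. by apply/eqP; move: b1; lra. Qed.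
Let b2_neq0 : b + 2 != 0. Proof. by apply/eqP; move: b1; lra. Qed.

(** Since [coefQ b = b / (b + 2) * coefN b], [g3_f3] makes it a multiple of [g * f3 b], and the
    division by [f3 b] disappears. *)
Lemma e3E : e3 b = - s - 2 * (b + 1) / (b + 2) * g.
Proof.
have gf := g3_f3; rewrite /Defs.coefN in gf.
rewrite /e3 i3E /j3 /Defs.coefQ; apply: (mulIf f_neq0).
transitivity (- s * f3 b - g * f3 b
  + b * (b ^+ 2 / 2 - 1 / 6) * (b + 1) / 4); first by field.
transitivity (- s * f3 b - 2 * (b + 1) / (b + 2) * (g * f3 b));
  last by ring.
by rewrite gf; field.
Qed.

Lemma d3E : d3 b = (s - 1) / 2 + (b - 1) / (b + 1) * g.
Proof.
rewrite /d3 -/g i3E; apply: (mulIf f_neq0).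
(* [f3 b] is expanded only against [(s - 1) / 2]; in the other summand [g * f3 b] becomes
   [coefN b / 2], which has the factor [b + 1]. *)
transitivity ((s - 1) / 2 * (g + (s + 1) / 2)
  + (b - 1) / (b + 1) * (g * f3 b)); last by rewrite -f3E; ring.
rewrite g3_f3 invfM [_ * (2^-1 * _)]mulrA divfK//.
apply: (@eq_subr_eq0 _ _ _ ((g ^+ 2 - (Defs.coefN b / 2 - (s + 1) / 2 * g))
  - (s ^+ 2 - Defs.coefM b) / 4)).
  by rewrite g3_sqr sqr_sqrtM !subrr mul0r subr0.
by rewrite /Defs.coefR /Defs.coefN /Defs.coefM; field.
Qed.

Let hs : s ^+ 2 - Defs.coefM b = 0. Proof. by rewrite sqr_sqrtM subrr. Qed.
Let hg : g ^+ 2 - (Defs.coefN b / 2 - (s + 1) / 2 * g) = 0.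
Proof. by rewrite g3_sqr subrr. Qed.

(** When [x - y] is quadratic in [s] and [g], the cofactors [k] and [l] are its coefficients of
    [s ^+ 2] and [g ^+ 2]. *)
Lemma eq_mod_sg (x y k l : R) :
  x - y = k * (s ^+ 2 - Defs.coefM b)
          + l * (g ^+ 2 - (Defs.coefN b / 2 - (s + 1) / 2 * g)) ->
  x = y.
Proof. by rewrite hs hg !mulr0 addr0 => /subr0_eq. Qed.

(** * Gram entries and positivity of [c3] and [a3] *)

Definition gram22 : R := Defs.coefS b - e3 b ^+ 2 - g3 b ^+ 2 - h3 b ^+ 2.
Definition gram33 : R := Defs.coefW b - g3 b ^+ 2 - d3 b ^+ 2.
Definition gram32 : R := Defs.coefU b / 2 - d3 b * e3 b - g3 b * h3 b.

(** Numerators in normal form: combinations of 1, [s], [g] and [s * g] over the polynomials in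
    [b]. *)
Let num22 : R := b ^+ 4 + 4 * b ^+ 3 + 31 / 6 * b ^+ 2 + 17 / 6 * b + 1
  + (b + 2) ^+ 2 / 2 * s + 2 * g * ((b + 1) ^+ 2 + s).
Let num33 : R := b ^+ 4 + 4 * b ^+ 3 + 14 / 3 * b ^+ 2 + 5 / 3 * b
  + (b + 1) ^+ 2 / 2 * s + 2 * g * (b ^+ 2 + s).
Let num32 : R :=
  1 / 6 - 7 / 4 * b - 59 / 12 * b ^+ 2 - 4 * b ^+ 3 - b ^+ 4
  - (b + 1) * (b + 2) / 2 * s - 2 * g * (b + b ^+ 2 + s).

Lemma gram22E : gram22 = num22 / (b + 2) ^+ 2.
Proof.
apply: (@eq_mod_sg _ _ (- 5 / 4) (- (4 * ((b + 1) / (b + 2)) ^+ 2 + 2))).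
rewrite /gram22 -/g e3E h3E /num22 /Defs.coefS /Defs.coefM /Defs.coefN.
by move: (s) (g) => s' g'; field.
Qed.

Lemma gram33E : gram33 = num33 / (b + 1) ^+ 2.
Proof.
apply: (@eq_mod_sg _ _ (- 1 / 4) (- (((b - 1) / (b + 1)) ^+ 2 + 1))).
rewrite /gram33 -/g d3E /num33 /Defs.coefW /Defs.coefM /Defs.coefN.
by move: (s) (g) => s' g'; field.
Qed.

Lemma gram32E : gram32 = num32 / ((b + 1) * (b + 2)).
Proof.
apply: (@eq_mod_sg _ _ (1 / 2)
  (2 * ((b - 1) / (b + 1)) * ((b + 1) / (b + 2)) + 1)).
rewrite /gram32 -/g d3E e3E h3E /num32 /Defs.coefU /Defs.coefM /Defs.coefN.
by move: (s) (g) => s' g'; field; rewrite b1_neq0 b2_neq0.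
Qed.

(** The pure [s ^+ 2] terms cancel, and those in [g ^+ 2] leave only [4 * s * g ^+ 2], whence the
    cofactor [4 * s]; reducing it leaves [- s ^+ 2 * g], whence [- g]. *)
Lemma num_det : num22 * num33 - num32 ^+ 2 =
  - 1 / 36 + 9 / 4 * b + 1147 / 144 * b ^+ 2 + 239 / 24 * b ^+ 3
  + 253 / 48 * b ^+ 4 + b ^+ 5
  + s * (7 / 6 + 13 / 4 * b + 17 / 6 * b ^+ 2 + 3 / 4 * b ^+ 3)
  + g * (1 / 3 + 13 / 3 * b + 22 / 3 * b ^+ 2 + 3 * b ^+ 3
         + (5 / 3 + 2 * b) * s).
Proof.
apply: (@eq_mod_sg _ _ (- g) (4 * s)).
rewrite /num22 /num33 /num32 /Defs.coefM /Defs.coefN.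
by move: (s) (g) => s' g'; field.
Qed.

(* The larger root of [X ^+ 2 - coefP * X - coefN / 2] is [f3], the smaller
   one is [- g3], hence [- g3 <= coefP / 2]: this bound alone is enough. *)
Let num_ge (d : R) : 0 <= d -> 0 <= (g + (s + 1) / 4) * d.
Proof. by move=> d0; rewrite mulr_ge0//; have := g3_ge; lra. Qed.

Lemma gram22_gt0 : 0 < gram22.
Proof.
rewrite gram22E divr_gt0 ?exprn_gt0//; last by move: b1; lra.
have b0 : 0 <= b by move: b1; lra.
have s0 := sqrtM_ge0; have := mulr_ge0 b0 s0; have hs' := hs.
(* Replacing [g] by [- (s + 1) / 4] and [s ^+ 2] by [coefM b] in [num22] leaves [b ^+ 3 + 5 / 2 * b
   ^+ 2 + 2 * b + 2 / 3 + (b + 1) * s]. *)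
have := @num_ge ((b + 1) ^+ 2 + s) (addr_ge0 (sqr_ge0 _) s0).
rewrite /Defs.coefM in hs'; pos_powers b0.
by rewrite /num22; move: (s) (g) b1 s0 hs' => s' g'; lra.
Qed.

Lemma gram_det_gt0 : 0 < gram22 * gram33 - gram32 ^+ 2.
Proof.
have b0 : 0 <= b by move: b1; lra.
have -> : gram22 * gram33 - gram32 ^+ 2 =
    (num22 * num33 - num32 ^+ 2) / ((b + 1) * (b + 2)) ^+ 2.
  by rewrite gram22E gram33E gram32E; field; rewrite b1_neq0 b2_neq0.
rewrite divr_gt0 ?exprn_gt0 ?mulr_gt0//; try by move: b1; lra.
rewrite num_det.
have s0 := sqrtM_ge0; have bs0 := mulr_ge0 b0 s0; have b2s0 := mulr_ge0 b0 bs0.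
have b3s0 := mulr_ge0 b0 b2s0.
have hs' := hs; rewrite /Defs.coefM in hs'.
(* The lower bound for [g] times its coefficient produces [b * s ^+ 2]. After substitution the terms
   in [b ^+ 5] and [b ^+ 3 * s] cancel and all other coefficients are positive. *)
have hbs : b * s ^+ 2 = b * Defs.coefM b by rewrite sqr_sqrtM.
rewrite /Defs.coefM in hbs.
have d0 : 0 <= 1 / 3 + 13 / 3 * b + 22 / 3 * b ^+ 2 + 3 * b ^+ 3
    + (5 / 3 + 2 * b) * s.
  by pos_powers b0; lra.
have := num_ge d0; pos_powers b0.
by move: (s) (g) b1 s0 hs' hbs bs0 b2s0 b3s0 {d0} => s' g'; lra.
Qed.

Lemma c3_gt0 : 0 < c3 b.
Proof. by rewrite sqrtr_gt0 gram22_gt0. Qed.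

Let c_neq0 : c3 b != 0. Proof. by rewrite gt_eqF// c3_gt0. Qed.

Lemma sqr_c3 : c3 b ^+ 2 = gram22.
Proof. by rewrite sqr_sqrtr// ltW// gram22_gt0. Qed.

Lemma b3_c3 : b3 b * c3 b = gram32.
Proof. by rewrite /b3 /gram32; field. Qed.

(** [a3 b] is the Schur complement of [gram22] in the symmetric matrix of entries [gram22],
    [gram32], [gram33], so it has the sign of the determinant. *)
Lemma a3_gt0 : 0 < a3 b.
Proof.
have aE : gram22 * a3 b = gram22 * gram33 - gram32 ^+ 2.
  by rewrite -b3_c3 exprMn sqr_c3 /a3 /gram33; ring.
by rewrite -(pmulr_rgt0 _ gram22_gt0) aE gram_det_gt0.
Qed.

(** * The identity for [A3] and [C3] *)

Lemma d3_f3 : 2 * (d3 b * f3 b) = Defs.coefR b - 2 * (g3 b * i3 b).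
Proof. by rewrite /d3; field. Qed.

Lemma e3_f3 : 2 * (e3 b * f3 b) = 2 * (i3 b * f3 b) - Defs.coefQ b.
Proof. by rewrite /e3 /j3; field. Qed.

Lemma A3_C3_identity (V : lmodType R) (ip : {dot V for idfun})
    (x3 x2 x1 x0 : V) :
  ip (A3 b x3 x2 x1 x0) (C3 b x3 x2 x1)
    = a3 b * ipnorm ip x3 ^+ 2 - a3 b * ipnorm ip x2 ^+ 2
      + ipnorm ip (b3 b *: x3 + c3 b *: x2) ^+ 2
      - ipnorm ip (b3 b *: x2 + c3 b *: x1) ^+ 2
      + ipnorm ip (d3 b *: x3 + e3 b *: x2 + f3 b *: x1) ^+ 2
      - ipnorm ip (d3 b *: x2 + e3 b *: x1 + f3 b *: x0) ^+ 2
      + ipnorm ip (g3 b *: x3 + h3 b *: x2 + i3 b *: x1 + j3 b *: x0) ^+ 2.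
Proof.
rewrite /A3 /C3 -!(scaleNr _ x2) -(scaleNr _ x0); apply: gram_form4.
- by rewrite /a3 /Defs.coefW; field.
- by rewrite sqr_c3 /a3 /gram22 /Defs.coefS /Defs.coefW; field.
(* Here, and for the products of [x2] with [x1] and [x0], the equality rests on the quadratic
   relations for [s] and [g]. *)
- rewrite sqr_c3 /gram22 h3E i3E f3E -/g /Defs.coefS.
  apply: (@eq_mod_sg _ _ (- 3 / 2) (- 4)).
  by rewrite /Defs.coefM /Defs.coefN; move: (s) (g) => s' g'; field.
- by [].
- by rewrite b3_c3 /gram32 /Defs.coefU; field.
- by rewrite d3_f3 /Defs.coefR; field.
- rewrite b3_c3 e3_f3 /gram32 h3E i3E f3E -/g /Defs.coefU /Defs.coefQ.
  apply: (@eq_mod_sg _ _ 2 2).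
  by rewrite /Defs.coefM /Defs.coefN; move: (s) (g) => s' g'; field.
- by rewrite g3_f3 /Defs.coefN; field.
- rewrite d3_f3 /j3 h3E i3E f3E -/g /Defs.coefR.
  apply: (@eq_mod_sg _ _ (- 1 / 2) 4).
  by rewrite /Defs.coefM /Defs.coefN; move: (s) (g) => s' g'; field.
- by rewrite e3_f3 /j3 /Defs.coefQ; field.
Qed.

Lemma variables_real_ge1 : variables_real b.
Proof.
split; first by split; rewrite mulf_neq0 ?pnatr_eq0.
split; [exact/ltW/coefM_gt0|exact: discriminant_ge0|exact/ltW/gram22_gt0].
Qed.

End NonhatCoefficients.

(** * Coefficients of the first identity and positivity of [hata3] *)

Section HatCoefficients.
Variables (R : realType) (b : R).
Hypothesis b1 : 1 <= b.

Let w := Num.sqrt (hatDelta3 b).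
Let p := Num.sqrt (hatP b).
Let q := Num.sqrt (hatQ b).
Let k := (b - 1) / (b + 1).

Let b1_gt0 : 0 < b + 1. Proof. by move: b1; lra. Qed.
Let b1_neq0 : b + 1 != 0. Proof. by rewrite gt_eqF. Qed.
Let b1_neq0' : 1 + b != 0. Proof. by rewrite addrC. Qed.

Lemma hatDelta3E :
  hatDelta3 b = 4 * b * (2 * b ^+ 2 + 4 * b + 1) / (b + 1) ^+ 2.
Proof. by rewrite /hatDelta3 /hatM /hatN; field. Qed.

Lemma hatDelta3_ge0 : 0 <= hatDelta3 b.
Proof.
rewrite hatDelta3E; have b0 : 0 <= b by move: b1; lra.
by rewrite !mulr_ge0 ?invr_ge0 ?exprn_ge0 ?addr_ge0 ?mulr_ge0.
Qed.

Let w_ge0 : 0 <= w. Proof. exact: sqrtr_ge0. Qed.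
Let sqr_w : w ^+ 2 = hatDelta3 b. Proof. by rewrite sqr_sqrtr ?hatDelta3_ge0. Qed.

Lemma hatM_ge0 : 0 <= hatM b.
Proof.
have b0 : 0 <= b by move: b1; lra.
by rewrite divr_ge0 ?(ltW b1_gt0)// !addr_ge0 ?mulr_ge0 ?exprn_ge0.
Qed.

Lemma hate3_radicand_ge0 : 0 <= (hatM b - w) / 2.
Proof.
rewrite divr_ge0// subr_ge0 -(@ler_pXn2r _ 2) ?nnegrE ?hatM_ge0//.
rewrite sqr_w /hatDelta3 gerBl mulr_ge0//.
by rewrite /hatN divr_ge0 ?sqr_ge0.
Qed.

Lemma sqr_hate3 : hate3 b ^+ 2 = (hatM b - w) / 2.
Proof. by rewrite sqrrN sqr_sqrtr// hate3_radicand_ge0. Qed.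

Lemma hatQE : hatQ b = (hatM b + w) / 2.
Proof. by rewrite /hatQ sqr_hate3 -/(hatM b); field. Qed.

Lemma hatPE : hatP b = hatQ b - b * (b + 1).
Proof. by rewrite /hatP /hatQ; field. Qed.

Lemma hatP_ge0 : 0 <= hatP b.
Proof.
(* As [2 * hatP b = w - (b - 1) / (b + 1)], a lower bound for [w] suffices. *)
have wb : b / (b + 1) <= w.
  rewrite -(@ler_pXn2r _ 2) ?nnegrE ?divr_ge0 ?(ltW b1_gt0)//;
    last by move: b1; lra.
  rewrite sqr_w hatDelta3E expr_div_n ler_pM2r ?invr_gt0 ?exprn_gt0//.
  by move: b1; nra.
have -> : hatP b = ((w - b / (b + 1)) + 1 / (b + 1)) / 2.
  by rewrite hatPE hatQE /hatM; field.
by rewrite divr_ge0// addr_ge0 ?subr_ge0// divr_ge0// ltW.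
Qed.

Lemma hatP_lt_hatQ : hatP b < hatQ b.
Proof. by rewrite hatPE gtrBl mulr_gt0//; move: b1; lra. Qed.

Lemma hatQ_ge0 : 0 <= hatQ b.
Proof. exact: le_trans hatP_ge0 (ltW hatP_lt_hatQ). Qed.

Let sqr_p : p ^+ 2 = hatP b. Proof. by rewrite sqr_sqrtr ?hatP_ge0. Qed.
Let sqr_q : q ^+ 2 = hatQ b. Proof. by rewrite sqr_sqrtr ?hatQ_ge0. Qed.

Lemma hatf3_gt0 : 0 < hatf3 b.
Proof.
rewrite divr_gt0// addrC subr_gt0 ltr_sqrt ?hatP_lt_hatQ//.
exact: le_lt_trans hatP_ge0 hatP_lt_hatQ.
Qed.

Let f_neq0 : hatf3 b != 0. Proof. by rewrite gt_eqF// hatf3_gt0. Qed.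

Lemma hatd3E : hatd3 b = (p + q) / 2.
Proof. by rewrite /hatd3 /hatf3 -/p -/q; field. Qed.

(** [hate3 b ^+ 2] and [hatQ b] are the roots of [X ^+ 2 - hatM b * X + hatN b], so their product is
    the square [hatN b]; the sign is that of [hate3]. *)
Lemma hate3_hatQ : hate3 b * q = - ((2 * b ^+ 2 + 2 * b - 1) / 2).
Proof.
rewrite /hate3 -/w mulNr; congr (- _).
rewrite /q -sqrtrM ?hate3_radicand_ge0// hatQE.
have -> : (hatM b - w) / 2 * ((hatM b + w) / 2)
    = ((2 * b ^+ 2 + 2 * b - 1) / 2) ^+ 2.
  have -> : (hatM b - w) / 2 * ((hatM b + w) / 2) = (hatM b ^+ 2 - w ^+ 2) / 4.
    by field.
  by rewrite sqr_w /hatDelta3 /hatN; field.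
rewrite sqrtr_sqr ger0_norm// divr_ge0//.
by have := b1; have := sqr_ge0 b; lra.
Qed.

Lemma hatd3_hatf3 : hatd3 b * hatf3 b = b * (b + 1) / 4.
Proof.
rewrite hatd3E /hatf3 -/p -/q.
transitivity ((q ^+ 2 - p ^+ 2) / 4); first by field.
by rewrite sqr_p sqr_q hatPE; field.
Qed.

Lemma sqr_hatd3_hatf3 : hatd3 b ^+ 2 + hatf3 b ^+ 2 = (hatP b + hatQ b) / 2.
Proof. by rewrite -sqr_p -sqr_q hatd3E /hatf3 -/p -/q; field. Qed.

Lemma hatd3_hate3 : hatd3 b * hate3 b
  = - ((2 * b ^+ 2 + 2 * b - 1) / 2) - hate3 b * hatf3 b.
Proof. by rewrite -hate3_hatQ hatd3E /hatf3 -/p -/q; field. Qed.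

Lemma hatb3_hatf3 : hatb3 b * hatf3 b = b * (b - 1) / 4 + hate3 b * hatf3 b.
Proof. by rewrite /hatb3 /hatc3; field. Qed.

(** The terms [b * (b - 1) / 4] and [b * (b + 1) / 4] of [hatb3_hatf3] and [hatd3_hatf3] have ratio
    [k]. *)
Lemma hatb3E : hatb3 b = k * hatd3 b + hate3 b.
Proof.
apply: (mulIf f_neq0).
transitivity (k * (hatd3 b * hatf3 b) + hate3 b * hatf3 b); last by ring.
by rewrite hatb3_hatf3 hatd3_hatf3 /k; field.
Qed.

Lemma D3_C3_identity (V : lmodType R) (ip : {dot V for idfun}) (x2 x1 x0 : V) :
  ip (D3 b x2 x1) (C3 b x2 x1 x0)
    = hata3 b * ipnorm ip x2 ^+ 2 - hata3 b * ipnorm ip x1 ^+ 2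
      + ipnorm ip (hatb3 b *: x2 + hatc3 b *: x1) ^+ 2
      - ipnorm ip (hatb3 b *: x1 + hatc3 b *: x0) ^+ 2
      + ipnorm ip (hatd3 b *: x2 + hate3 b *: x1 + hatf3 b *: x0) ^+ 2.
Proof.
rewrite /D3 /C3 -(scaleNr _ x1) -[X in ip (X + _)]scale1r.
apply: gram_form3 => //.
- by rewrite /hata3; field.
- transitivity (- (b ^+ 2 / 2 + 3 * b / 2 + 1)
    + (hatd3 b ^+ 2 + hatf3 b ^+ 2) + hate3 b ^+ 2).
    by rewrite sqr_hatd3_hatf3 /hatP /hatQ; field; rewrite ?b1_neq0 ?b1_neq0'.
  by rewrite /hata3 /hatc3; ring.
- by rewrite /hatc3 hatb3_hatf3 hatd3_hate3; field.
- by rewrite hatd3_hatf3; field.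
- by rewrite /hatc3 hatb3_hatf3; field.
Qed.

(** The squares of [p], [q], [hate3 b] and the product [hate3 b * q] are all rational in [b] and
    [w]; [X] collects these, and [p * Y] the terms odd in [p]. *)
Let X : R := ((b ^+ 3 + b ^+ 2 + 5 * b + 1) / 2 + b * (b + 1) * w)
  / (b + 1) ^+ 3.
Let Y : R := (1 + k ^+ 2) * q / 2 + k * hate3 b.

Let hata3E : hata3 b = X - p * Y.
Proof.
rewrite /hata3 hatb3E.
transitivity (b ^+ 2 / 2 + 3 * b / 2 + 1
  - (1 + k ^+ 2) * (p ^+ 2 + q ^+ 2 + 2 * (p * q)) / 4
  - k * (p * hate3 b + hate3 b * q) - hate3 b ^+ 2).
  by rewrite hatd3E; field.
rewrite sqr_p sqr_q hate3_hatQ sqr_hate3 hatPE hatQE /X /Y /hatM /k.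
by field.
Qed.

Let sqr_X : X ^+ 2 - (p * Y) ^+ 2 = 1 / 4.
Proof.
transitivity (X ^+ 2 - p ^+ 2 * ((1 + k ^+ 2) ^+ 2 * q ^+ 2 / 4
  + (1 + k ^+ 2) * k * (hate3 b * q) + k ^+ 2 * hate3 b ^+ 2)).
  by rewrite /Y; field.
(* What remains is a rational identity in [b] and [w]. *)
rewrite sqr_p sqr_q hate3_hatQ sqr_hate3 hatPE hatQE /X /hatM /k.
by field.
Qed.

Lemma hata3_gt0 : 0 < hata3 b.
Proof.
have b0 : 0 <= b by move: b1; lra.
have X0 : 0 <= X.
  by rewrite divr_ge0 ?exprn_ge0 ?(ltW b1_gt0)// addr_ge0 ?mulr_ge0 ?addr_ge0
    ?mulr_ge0 ?exprn_ge0.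
(* Comparing [X] with the absolute value of [p * Y] avoids the sign of [Y]; the squares differ by
   1/4. *)
rewrite hata3E subr_gt0; apply: (le_lt_trans (ler_norm _)).
rewrite -(@ltr_pXn2r _ 2) ?nnegrE// real_normK ?num_real// -subr_gt0 sqr_X.
by rewrite divr_gt0.
Qed.

Lemma hat_variables_real_ge1 : hat_variables_real b.
Proof.
split; first by rewrite mulf_neq0.
split; [exact: hatDelta3_ge0|exact: hate3_radicand_ge0|exact: hatP_ge0
       |exact: hatQ_ge0].
Qed.

End HatCoefficients.

(** * Boundedness of the coefficients on the interval from 1 to 100 *)

Section Boundedness.
Variable R : realType.

(** An explicit constant makes the closure lemmas direct; [bddP] passes to the filter
    formulation. *)
Definition bounded_1_100 (f : R -> R) :=
  exists K, forall b, 1 <= b <= 100 -> `|f b| <= K.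

Lemma bddP (f : R -> R) : bounded_1_100 f -> [bounded f b | b in `[1, 100]].
Proof.
move=> [K fK]; rewrite /bounded_near; near=> M => b /=; rewrite in_itv/= => hb.
apply: (le_trans (fK b hb)).
by near: M; apply: nbhs_pinfty_ge; rewrite num_real.
Unshelve. all: by end_near. Qed.

Lemma bdd_cst (c : R) : bounded_1_100 (fun=> c).
Proof. by exists `|c|. Qed.

Lemma bdd_id : bounded_1_100 (fun b => b).
Proof.
by exists 100 => b /andP[h1 h100]; rewrite ger0_norm//; apply: le_trans h1.
Qed.

Lemma bddN f : bounded_1_100 f -> bounded_1_100 (fun b => - f b).
Proof. by move=> [K fK]; exists K => b /fK; rewrite normrN. Qed.

Lemma bddD f g :
  bounded_1_100 f -> bounded_1_100 g -> bounded_1_100 (fun b => f b + g b).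
Proof.
move=> [K fK] [L gL]; exists (K + L) => b hb.
by rewrite (le_trans (ler_normD _ _))// lerD ?fK ?gL.
Qed.

Lemma bddM f g :
  bounded_1_100 f -> bounded_1_100 g -> bounded_1_100 (fun b => f b * g b).
Proof.
move=> [K fK] [L gL]; exists (K * L) => b hb.
by rewrite normrM ler_pM ?fK ?gL.
Qed.

Lemma bddX f n : bounded_1_100 f -> bounded_1_100 (fun b => f b ^+ n).
Proof.
move=> [K fK]; exists (K ^+ n) => b hb; have h := fK b hb.
by rewrite normrX lerXn2r ?nnegrE ?(le_trans _ h).
Qed.

Lemma bdd_sqrt f : bounded_1_100 f -> bounded_1_100 (fun b => Num.sqrt (f b)).
Proof.
move=> [K fK]; exists (Num.sqrt K) => b hb; have h := fK b hb.
rewrite ger0_norm ?sqrtr_ge0// ler_wsqrtr//.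
exact: le_trans (ler_norm _) h.
Qed.

(** Handles the denominators [b + 1]; quotients by [f3], [c3] and [hatc3] go through
    [bdd_sqr_le]. *)
Lemma bdd_inv : bounded_1_100 (fun b => (b + 1)^-1).
Proof.
exists 1 => b /andP[h1 _]; have b0 : 0 < b + 1 by lra.
by rewrite ger0_norm ?invr_ge0 ?(ltW b0)// invf_le1//; lra.
Qed.

Lemma bdd_sqr_le f g : (forall b, 1 <= b -> f b ^+ 2 <= g b) ->
  bounded_1_100 g -> bounded_1_100 f.
Proof.
(* The bound [K + 1] comes from [x <= x ^+ 2 + 1]. *)
move=> fg [K gK]; exists (K + 1) => b hb; have h := gK b hb.
have : `|f b| ^+ 2 <= K.
  rewrite real_normK ?num_real// (le_trans (fg b _))//.
    by case/andP: hb.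
  exact: le_trans (ler_norm _) h.
by move: `|f b| => x; nra.
Qed.

Ltac bdd := repeat first [assumption | apply: bdd_cst | apply: bdd_id
  | apply: bdd_inv | apply: bddD | apply: bddN | apply: bddM | apply: bddX
  | apply: bdd_sqrt].

Lemma bounded_hat_variables (f : R -> R) :
  List.In f (hat_variables R) -> bounded_1_100 f.
Proof.
have bM : bounded_1_100 (@hatM R) by rewrite /hatM; bdd.
have bN : bounded_1_100 (@hatN R) by rewrite /hatN; bdd.
have bDelta : bounded_1_100 (@hatDelta3 R) by rewrite /hatDelta3; bdd.
have be : bounded_1_100 (@hate3 R) by rewrite /hate3; bdd.
have bP : bounded_1_100 (@hatP R) by rewrite /hatP; bdd.
have bQ : bounded_1_100 (@hatQ R) by rewrite /hatQ; bdd.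
have bf : bounded_1_100 (@hatf3 R) by rewrite /hatf3; bdd.
have bd : bounded_1_100 (@hatd3 R) by rewrite /hatd3; bdd.
have bb : bounded_1_100 (@hatb3 R).
  apply: (@bdd_sqr_le _ (fun b => b ^+ 2 / 2 + 3 * b / 2 + 1)); last by bdd.
  move=> b b1; have := hata3_gt0 b1; rewrite /hata3.
  by have := sqr_ge0 (hatd3 b); lra.
have ba : bounded_1_100 (@hata3 R) by rewrite /hata3; bdd.
by rewrite /hat_variables /=; intuition (subst; assumption).
Qed.

Lemma bounded_variables (f : R -> R) :
  List.In f (variables R) -> bounded_1_100 f.
Proof.
have bM : bounded_1_100 (@Defs.coefM R) by rewrite /Defs.coefM; bdd.
have bN : bounded_1_100 (@Defs.coefN R) by rewrite /Defs.coefN; bdd.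
have bP : bounded_1_100 (@Defs.coefP R) by rewrite /Defs.coefP; bdd.
have bQ : bounded_1_100 (@Defs.coefQ R) by rewrite /Defs.coefQ; bdd.
have bR : bounded_1_100 (@Defs.coefR R) by rewrite /Defs.coefR; bdd.
have bS : bounded_1_100 (@Defs.coefS R) by rewrite /Defs.coefS; bdd.
have bW : bounded_1_100 (@Defs.coefW R) by rewrite /Defs.coefW; bdd.
have bU : bounded_1_100 (@Defs.coefU R) by rewrite /Defs.coefU; bdd.
have bf : bounded_1_100 (@f3 R) by rewrite /f3; bdd.
have bg : bounded_1_100 (@g3 R) by rewrite /g3; bdd.
have bi : bounded_1_100 (@i3 R) by rewrite /i3; bdd.
have bh : bounded_1_100 (@h3 R) by rewrite /h3; bdd.
(* Positivity of [gram22] bounds the square of [e3], and positivity of [a3] those of [d3] and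
   [b3]. *)
have be : bounded_1_100 (@e3 R).
  apply: (@bdd_sqr_le _ (@Defs.coefS R)) => // b b1.
  have := gram22_gt0 b1; rewrite /gram22.
  by have := sqr_ge0 (g3 b); have := sqr_ge0 (h3 b); lra.
have bd : bounded_1_100 (@d3 R).
  apply: (@bdd_sqr_le _ (@Defs.coefW R)) => // b b1.
  have := a3_gt0 b1; rewrite /a3.
  by have := sqr_ge0 (g3 b); have := sqr_ge0 (b3 b); lra.
have bb : bounded_1_100 (@b3 R).
  apply: (@bdd_sqr_le _ (@Defs.coefW R)) => // b b1.
  have := a3_gt0 b1; rewrite /a3.
  by have := sqr_ge0 (g3 b); have := sqr_ge0 (d3 b); lra.
have bc : bounded_1_100 (@c3 R) by rewrite /c3; bdd.
have ba : bounded_1_100 (@a3 R) by rewrite /a3; bdd.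
by rewrite /variables /=; intuition (subst; assumption).
Qed.

End Boundedness.

(** * Assembly of the identities and of the claims on the coefficients *)

Lemma In_cat (T : Type) (x : T) (s t : seq T) :
  List.In x (s ++ t) -> List.In x s \/ List.In x t.
Proof. by elim: s => [|y s IHs] /=; [right|case=> [->|/IHs[]]; auto]. Qed.

Theorem proposition3p2 (R : realType) (V : lmodType R)
    (ip : {dot V for idfun}) :
  (forall (beta : R) (phi_nm2 phi_nm1 phi_n phi_np1 : V), 1 <= beta ->
    (hatDelta3 beta
       = 4 * beta * (2 * beta ^+ 2 + 4 * beta + 1) / (beta + 1) ^+ 2
     /\
     ip (D3 beta phi_np1 phi_n) (C3 beta phi_np1 phi_n phi_nm1)
       = hata3 beta * ipnorm ip phi_np1 ^+ 2
         - hata3 beta * ipnorm ip phi_n ^+ 2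
         + ipnorm ip (hatb3 beta *: phi_np1 + hatc3 beta *: phi_n) ^+ 2
         - ipnorm ip (hatb3 beta *: phi_n + hatc3 beta *: phi_nm1) ^+ 2
         + ipnorm ip (hatd3 beta *: phi_np1 + hate3 beta *: phi_n
                      + hatf3 beta *: phi_nm1) ^+ 2)
    /\
    ip (A3 beta phi_np1 phi_n phi_nm1 phi_nm2)
       (C3 beta phi_np1 phi_n phi_nm1)
      = a3 beta * ipnorm ip phi_np1 ^+ 2
        - a3 beta * ipnorm ip phi_n ^+ 2
        + ipnorm ip (b3 beta *: phi_np1 + c3 beta *: phi_n) ^+ 2
        - ipnorm ip (b3 beta *: phi_n + c3 beta *: phi_nm1) ^+ 2
        + ipnorm ip (d3 beta *: phi_np1 + e3 beta *: phi_n
                     + f3 beta *: phi_nm1) ^+ 2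
        - ipnorm ip (d3 beta *: phi_n + e3 beta *: phi_nm1
                     + f3 beta *: phi_nm2) ^+ 2
        + ipnorm ip (g3 beta *: phi_np1 + h3 beta *: phi_n
                     + i3 beta *: phi_nm1 + j3 beta *: phi_nm2) ^+ 2)
  /\
  ((forall beta : R, 1 <= beta <= 100 ->
      [/\ hat_variables_real beta, variables_real beta,
          0 < hata3 beta & 0 < a3 beta])
   /\
   (forall f : R -> R, List.In f (hat_variables R ++ variables R) ->
      [bounded f beta | beta in `[1, 100]])).
Proof.
split.
  move=> beta x0 x1 x2 x3 beta1; split; last exact: A3_C3_identity.
  by split; [exact: hatDelta3E|exact: D3_C3_identity].
split.
  move=> beta /andP[beta1 _]; split.
  - exact: hat_variables_real_ge1.
  - exact: variables_real_ge1.
  - exact: hata3_gt0.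
  - exact: a3_gt0.
move=> f hf; apply: bddP.
by have [/bounded_hat_variables|/bounded_variables] := In_cat hf.
Qed.
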